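(* Let $\mathcal A$ be a $W^*$-algebra. For any bounded set $E\subseteq l^2(\mathcal A)$ we have $\chi^*(E)\le\lambda(E)$.
   Context: $l^2(\mathcal A)$ is the standard Hilbert module: the right $\mathcal A$-module of all sequences $x=(\xi_1,\xi_2,\dots)$ in $\mathcal A$ for which $\sum_{j}\xi_j^*\xi_j$ converges in norm, with $\mathcal A$-valued inner product $\langle x,y\rangle=\sum_j\xi_j^*\eta_j$ (for $y=(\eta_1,\eta_2,\dots)$) and norm $\|x\|=\|\langle x,x\rangle\|^{1/2}$. A free finitely generated submodule $M\le l^2(\mathcal A)$ is a closed $\mathcal A$-submodule isomorphic, as a Hilbert $\mathcal A$-module, to $\mathcal A^n$ for some $n\in\mathbb N$. For a bounded set $E$, $\lambda(E)$ is the greatest lower bound of all $\eta>0$ for which there is a free finitely generated submodule $M\le l^2(\mathcal A)$ with $\sup_{x\in E}\inf_{y\in M}\|x-y\|<\eta$. Let $P$ be the set of all semi-norms $p_{\varphi,y}(x)=\sqrt{\sum_{j=1}^\infty|\varphi(\eta_j^*\xi_j)|^2}$, $x=(\xi_1,\xi_2,\dots)\in l^2(\mathcal A)$, where $\varphi\in\mathcal A_*$ is a normal state and $y=(\eta_1,\eta_2,\dots)$ is a sequence of elements of $\mathcal A$ with $\sup_{j\ge1}\varphi(\eta_j^*\eta_j)=1$. For $p\in P$, $[\chi(E)](p)$ is the infimum of all $\varepsilon>0$ such that $E\subseteq\bigcup_{i=1}^n\{z: p(z-x_i)<\varepsilon\}$ for some finitely many $x_1,\dots,x_n\in l^2(\mathcal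 A)$, and $\chi^*(E)=\sup_{p\in P}[\chi(E)](p)$. *)

(* Defs.v *)
From HB Require Import structures.
From mathcomp Require Import all_boot all_order all_algebra.
From mathcomp Require Import complex.
From mathcomp Require Import all_classical all_reals all_analysis.
Import Order.TTheory GRing.Theory Num.Theory.
Import numFieldNormedType.Exports.

Set Implicit Arguments.
Unset Strict Implicit.
Unset Printing Implicit Defensive.

Local Open Scope classical_set_scope.
Local Open Scope ring_scope.
Local Open Scope complex_scope.

(* A unital C*-algebra, possibly zero.  The library has no common
   generalization of rings and normed modules other than numDomainType, so the
   ring operations are part of the mixin; the ring structure follows as an
   instance. *)
HB.mixin Record isCStarAlgebra (R : realType) A
    of CompleteNormedModule R[i] A := {
  cstar_one : A ;
  cstar_mul : A -> A -> A ;
  star : A -> A ;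
  cstar_mulA : associative cstar_mul ;
  cstar_mul1 : left_id cstar_one cstar_mul ;
  cstar_mulr1 : right_id cstar_one cstar_mul ;
  cstar_mulDl : left_distributive cstar_mul +%R ;
  cstar_mulDr : right_distributive cstar_mul +%R ;
  cstar_scaleAl : forall (c : R[i]) (a b : A),
    c *: cstar_mul a b = cstar_mul (c *: a) b ;
  cstar_scaleAr : forall (c : R[i]) (a b : A),
    c *: cstar_mul a b = cstar_mul a (c *: b) ;
  cstar_normM : forall a b : A, `|cstar_mul a b| <= `|a| * `|b| ;
  starK : involutive star ;
  starD : {morph star : a b / a + b} ;
  starZ : forall (c : R[i]) (a : A), star (c *: a) = (c^*)%C *: star a ;
  starM : forall a b : A, star (cstar_mul a b) = cstar_mul (star b) (star a) ;
  cstar_norm : forall a : A, `|cstar_mul (star a) a| = `|a| ^+ 2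
}.

#[short(type="cstarAlgType")]
HB.structure Definition CStarAlgebra (R : realType) :=
  {A of isCStarAlgebra R A & CompleteNormedModule R[i] A}.

#[non_forgetful_inheritance]
HB.instance Definition _ (R : realType) (A : cstarAlgType R) :=
  GRing.Zmodule_isPzRing.Build (CStarAlgebra.sort A)
    (@cstar_mulA R A) (@cstar_mul1 R A) (@cstar_mulr1 R A)
    (@cstar_mulDl R A) (@cstar_mulDr R A).

(* Norms of normed spaces over R[i] take their values in R[i]; [rnorm] is the
   same norm as a real number. *)
Definition rnorm (R : realType) (V : normedModType R[i]) (v : V) : R :=
  complex.Re `|v|.

Definition opnorm (R : realType) (V : normedModType R[i]) (f : V -> R[i]) :
    \bar R :=
  ereal_sup [set (complex.Re `|f v|)%:E | v in [set v : V | rnorm v <= 1]].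

(* A W*-algebra: a C*-algebra which is the dual of a Banach space [predual],
   that is, [a |-> pairing a] is an isometric linear isomorphism onto the
   space of bounded linear functionals on [predual]. *)
Record wstarAlgType (R : realType) := WStarAlgebra {
  wstar_sort :> cstarAlgType R ;
  predual : completeNormedModType R[i] ;
  pairing : wstar_sort -> {linear predual -> R[i]^o} ;
  pairing_linear : forall (c : R[i]) (a b : wstar_sort) (f : predual),
    pairing (c *: a + b) f = c * pairing a f + pairing b f ;
  pairing_isometry : forall a : wstar_sort,
    opnorm (pairing a) = (rnorm a)%:E ;
  pairing_onto : forall g : {linear predual -> R[i]^o},
    (opnorm g < +oo)%E -> exists a : wstar_sort, forall f, pairing a f = g f
}.

Section StandardModule.
Variables (R : realType) (A : wstarAlgType R).

(* [phi] belongs to the canonical image of the predual in the dual of A. *)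
Definition normal (phi : A -> R[i]) : Prop :=
  exists f : predual A, forall a : A, phi a = pairing a f.

Definition state (phi : A -> R[i]) : Prop :=
  [/\ linear (phi : A -> R[i]^o),
      forall a : A, 0 <= phi (star a * a) & opnorm phi = 1%E].

Definition normal_state (phi : A -> R[i]) : Prop := normal phi /\ state phi.

Definition l2 : set (nat -> A) :=
  [set x | cvgn (series (fun j => star (x j) * x j))].

Definition l2_inner (x y : nat -> A) : A :=
  limn (series (fun j => star (x j) * y j)).

Definition l2_norm (x : nat -> A) : R := Num.sqrt (rnorm (l2_inner x x)).

Definition l2_bounded (E : set (nat -> A)) : Prop :=
  E `<=` l2 /\ exists C : R, forall x, E x -> l2_norm x <= C.

Definition ract (T : Type) (x : T -> A) (a : A) : T -> A := fun j => x j * a.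

Definition free_inner (n : nat) (u v : 'I_n -> A) : A :=
  \sum_(i < n) star (u i) * v i.

Definition l2_submodule (M : set (nat -> A)) : Prop :=
  [/\ M `<=` l2, M 0,
      forall x y, M x -> M y -> M (x + y) &
      forall x a, M x -> M (ract x a)].

Definition l2_closed (M : set (nat -> A)) : Prop :=
  forall x, l2 x ->
    (forall e : R, 0 < e -> exists2 y, M y & l2_norm (x - y) < e) -> M x.

(* M is isomorphic to A^n through a bijective module map preserving the
   A-valued inner products. *)
Definition isomorphic_free (M : set (nat -> A)) (n : nat) : Prop :=
  exists T : ('I_n -> A) -> (nat -> A),
    [/\ set_bij setT M T,
        forall u v, T (u + v) = T u + T v,
        forall u a, T (ract u a) = ract (T u) a &
        forall u v, l2_inner (T u) (T v) = free_inner u v].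

Definition free_fg_submodule (M : set (nat -> A)) : Prop :=
  [/\ l2_submodule M, l2_closed M & exists n : nat, isomorphic_free M n].

Definition l2_excess (E M : set (nat -> A)) : \bar R :=
  ereal_sup [set ereal_inf [set (l2_norm (x - y))%:E | y in M] | x in E].

Definition lambda (E : set (nat -> A)) : \bar R :=
  ereal_inf [set eta%:E | eta in [set eta : R | 0 < eta /\
    exists2 M, free_fg_submodule M & (l2_excess E M < eta%:E)%E]].

Definition p_seminorm (phi : A -> R[i]) (y x : nat -> A) : R :=
  Num.sqrt (limn (series
    (fun j => complex.Re `|phi (star (y j) * x j)| ^+ 2))).

Definition seminormsP : set ((nat -> A) -> R) :=
  [set p | exists phi y,
    [/\ normal_state phi,
        ereal_sup [set (complex.Re (phi (star (y j) * y j)))%:E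
                  | j in [set: nat]] = 1%E &
        p = p_seminorm phi y]].

Definition chi (E : set (nat -> A)) (p : (nat -> A) -> R) : \bar R :=
  ereal_inf [set eps%:E | eps in [set eps : R | 0 < eps /\
    exists (n : nat) (x : 'I_n -> (nat -> A)),
      (forall i, l2 (x i)) /\
      E `<=` \bigcup_(i in [set: 'I_n]) [set z | p (z - x i) < eps]]].

Definition chi_star (E : set (nat -> A)) : \bar R :=
  ereal_sup [set chi E p | p in seminormsP].

End StandardModule.

(* Main.v *)
From HB Require Import structures.
Require Import Defs.
From mathcomp Require Import all_boot all_order all_algebra.
From mathcomp Require Import complex.
From mathcomp Require Import all_classical all_reals all_analysis.
From mathcomp Require Import ring lra.

(** Fix a seminorm p of P, given by a state phi and a sequence eta, and a free
    finitely generated submodule M that comes within t of every point of the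
    bounded set E.  The Cauchy-Schwarz inequality for phi gives p(x) <= ||x||,
    so E lies within t of a bounded part of M with respect to p.  It remains to
    see that bounded parts of M are totally bounded for p; then a finite net
    of M with mesh d is a net of E with mesh t + d ([chi_le]).

    An element of M is a combination of the images t_1, ..., t_n of the basis
    vectors of A^n, with coefficients u_i for which phi(u_1^* u_1 + ... +
    u_n^* u_n) is bounded.  For a self-adjoint s one has
    phi(u^* s u) <= ||s|| phi(u^* u) ([state_compress]).  Applied to the tails s
    of the series of t_ij^* t_ij, which are small in norm, this shows that the
    coordinates phi(eta_j^* y_j) with j >= N contribute little to p(y), uniformly
    on bounded parts of M ([uniform_tail]).  The remaining N coordinates range
    over a bounded subset of a finite-dimensional space ([finite_net],
    [bounded_net]).

    The estimate p(x - y) <= ||x - y|| needs x - y to belong to the standard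
    module: its Gram series must converge in norm ([l2B]).  By the parallelogram
    law this reduces to the monotonicity of the norm on sums of elements
    a^* a, a theorem on C*-algebras.  Its proof here avoids spectra.  A
    self-adjoint h is called positive when ||t - h|| <= t for some real t.
    Square roots come from a convergent iteration ([sqrt1B]).  If k and l are
    commuting self-adjoint elements with k^2 + l^2 = t, then k + i l is a
    multiple of a unitary, so ||k^2|| <= t; this gives monotonicity on positive
    elements ([rnorm_pos_le]) and positivity of squares ([pos_sq]).  That a^* a
    is positive is Kaplansky's argument ([pos_star_mul]), with the comparison
    of the spectra of c^* c and c c^* replaced by an estimate on the growth of
    the powers of t - b ([rnorm_scal_sub_le]). *)

Import Order.TTheory GRing.Theory Num.Theory.
Import numFieldNormedType.Exports.

Set Implicit Arguments.
Unset Strict Implicit.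
Unset Printing Implicit Defensive.

Local Open Scope classical_set_scope.
Local Open Scope ring_scope.
Local Open Scope complex_scope.

(** * Real-valued norms and convergence *)

Section Norm.
Variable R : realType.
Implicit Type V : normedModType R[i].

Lemma normE V (v : V) : `|v| = (rnorm v)%:C.
Proof. by rewrite /rnorm RRe_real // ger0_real. Qed.

Lemma rnorm_ge0 V (v : V) : 0 <= rnorm v.
Proof. by rewrite -ler0c -normE. Qed.

Lemma rnorm0 V : rnorm (0 : V) = 0.
Proof. by rewrite /rnorm normr0. Qed.

Lemma rnorm_eq0 V (v : V) : rnorm v = 0 -> v = 0.
Proof. by move=> v0; apply/eqP; rewrite -normr_eq0 normE v0. Qed.

Lemma rnormN V (v : V) : rnorm (- v) = rnorm v.
Proof. by rewrite /rnorm normrN. Qed.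

Lemma rnormD V (u v : V) : rnorm (u + v) <= rnorm u + rnorm v.
Proof. by rewrite -lecR rmorphD /= -!normE ler_normD. Qed.

Lemma rnormZ V (c : R[i]) (v : V) : rnorm (c *: v) = complex.Re `|c| * rnorm v.
Proof.
apply: complexI; rewrite -normE normrZ (normE v) rmorphM /=.
by congr (_ * _); rewrite RRe_real.
Qed.

Lemma rnormZr V (t : R) (v : V) : 0 <= t -> rnorm (t%:C *: v) = t * rnorm v.
Proof. by move=> t0; rewrite rnormZ ger0_norm // ler0c. Qed.

Lemma rnorm_cvgP V (u : nat -> V) (l : V) : u @ \oo --> l <->
  forall e : R, 0 < e -> exists N, forall n, (N <= n)%N -> rnorm (l - u n) < e.
Proof.
split=> [/cvgrPdist_lt h e e0|h].
  have /h[N _ hN] : 0 < e%:C by rewrite ltcR.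
  by exists N => n Nn; rewrite -ltcR -normE; apply: hN.
apply/cvgrPdist_lt => e; rewrite ltcE /= => /andP[/eqP ie re].
have [N hN] := h _ re; exists N => // n /= /hN.
by rewrite ltcE normE /= ie eqxx.
Qed.

Lemma rnorm_cauchy (V : completeNormedModType R[i]) (u : nat -> V) :
  (forall e : R, 0 < e -> exists N, forall n m, (N <= n)%N -> (n <= m)%N ->
     rnorm (u m - u n) < e) -> cvgn u.
Proof.
move=> h; apply: cauchy_cvg; apply/cauchy_exP => e.
rewrite ltcE /= => /andP[/eqP ie re].
have [N hN] := h _ re; exists (u N); exists N => // n /= Nn.
rewrite -ball_normE /ball_ /= distrC normE ltcE /= ie eqxx.
exact: hN.
Qed.
End Norm.

(** * C*-algebras: self-adjoint elements and square roots *)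

Section CStar.
Variables (R : realType) (A : cstarAlgType R).
Implicit Types a b c h k x y z : A.

Lemma mulZl (s : R[i]) a b : (s *: a) * b = s *: (a * b).
Proof. exact: esym (cstar_scaleAl s a b). Qed.

Lemma mulZr (s : R[i]) a b : a * (s *: b) = s *: (a * b).
Proof. exact: esym (cstar_scaleAr s a b). Qed.

Lemma star0 : star (0 : A) = 0.
Proof. by apply: (addrI (star 0)); rewrite -starD !addr0. Qed.

Lemma starN a : star (- a) = - star a.
Proof. by apply: (addrI (star a)); rewrite -starD !subrr star0. Qed.

Lemma starB a b : star (a - b) = star a - star b.
Proof. by rewrite starD starN. Qed.

Lemma star_mul a b : star (a * b) = star b * star a.
Proof. exact: starM. Qed.

Lemma star1 : star (1 : A) = 1.
Proof. by rewrite -[LHS]mul1r -{1}[1]starK -star_mul mul1r starK. Qed.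

Lemma starZr (t : R) a : star (t%:C *: a) = t%:C *: star a.
Proof. by rewrite starZ conjc_real. Qed.

Lemma rnormM a b : rnorm (a * b) <= rnorm a * rnorm b.
Proof. by rewrite -lecR rmorphM /= -!normE; exact: cstar_normM. Qed.

Lemma rnorm_star_mul a : rnorm (star a * a) = rnorm a ^+ 2.
Proof.
by apply: complexI; rewrite -normE rmorphXn /= -normE; exact: cstar_norm.
Qed.

Lemma rnorm_le_star a : rnorm a <= rnorm (star a).
Proof.
have [a0|a0] := leP (rnorm a) 0; first exact: le_trans a0 (rnorm_ge0 _).
by rewrite -(ler_pM2r a0) -expr2 -rnorm_star_mul rnormM.
Qed.

Lemma rnorm_star a : rnorm (star a) = rnorm a.
Proof.
have := rnorm_le_star (star a); rewrite starK => h.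
by apply/eqP; rewrite eq_le h rnorm_le_star.
Qed.

Lemma rnorm1_le1 : rnorm (1 : A) <= 1.
Proof.
have := rnorm_star_mul 1; rewrite star1 mulr1 => e.
have := rnorm_ge0 (1 : A); nra.
Qed.

Lemma rnorm_scalar (t : R) : 0 <= t -> rnorm (t%:C *: (1 : A)) <= t.
Proof.
by move=> t0; rewrite rnormZr // -[leRHS]mulr1 ler_wpM2l // rnorm1_le1.
Qed.

Lemma rnormX_le a n : rnorm (a ^+ n) <= rnorm a ^+ n.
Proof.
elim: n => [|n IH]; first by rewrite !expr0 rnorm1_le1.
rewrite !exprS; apply: le_trans (rnormM _ _) _.
by rewrite ler_wpM2l // rnorm_ge0.
Qed.

(** Identities between limits are proved by bounding the norm of the defect: the
    operations involved are Lipschitz on bounded sets, so the defect at the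
    limit is at most a constant times the distance to a term of the sequence. *)
Lemma rnorm_small_eq0 (V : normedModType R[i]) (a : V) (K : R) :
  (forall e : R, 0 < e -> rnorm a <= K * e) -> a = 0.
Proof.
move=> h; apply: rnorm_eq0; apply/eqP; rewrite eq_le rnorm_ge0 andbT.
rewrite leNgt; apply/negP => a0.
have K0 : 0 < `|K| + 1 by rewrite ltr_pwDr.
have := h (rnorm a / (2 * (`|K| + 1))); rewrite divr_gt0 ?mulr_gt0 //.
move=> /(_ isT); apply/negP; rewrite -ltNge mulrCA.
rewrite -[ltRHS]mulr1 ltr_pM2l // ltr_pdivrMr ?mulr_gt0 // mul1r.
have := ler_norm K; lra.
Qed.

Definition selfadj a := star a = a.

Lemma selfadj1 : selfadj 1. Proof. exact: star1. Qed.
Lemma selfadjD a b : selfadj a -> selfadj b -> selfadj (a + b).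
Proof. by rewrite /selfadj starD => -> ->. Qed.
Lemma selfadjN a : selfadj a -> selfadj (- a).
Proof. by rewrite /selfadj starN => ->. Qed.
Lemma selfadjB a b : selfadj a -> selfadj b -> selfadj (a - b).
Proof. by move=> sa sb; apply: selfadjD => //; apply: selfadjN. Qed.
Lemma selfadjZ (t : R) a : selfadj a -> selfadj (t%:C *: a).
Proof. by rewrite /selfadj starZr => ->. Qed.
Lemma selfadjM a b : selfadj a -> selfadj b -> GRing.comm a b -> selfadj (a * b).
Proof. by rewrite /selfadj star_mul => -> -> ->. Qed.
Lemma selfadj_sq a : selfadj a -> selfadj (a * a).
Proof. by move=> sa; apply: selfadjM. Qed.
Lemma selfadj_star_mul a : selfadj (star a * a).
Proof. by rewrite /selfadj star_mul starK. Qed.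
Lemma selfadjX a n : selfadj a -> selfadj (a ^+ n).
Proof.
move=> sa; elim: n => [|n IH]; first by rewrite expr0; exact: selfadj1.
by rewrite exprS; apply: selfadjM => //; apply: commrX.
Qed.

Lemma rnorm_sq a : selfadj a -> rnorm (a * a) = rnorm a ^+ 2.
Proof. by move=> sa; rewrite -rnorm_star_mul sa. Qed.

(** The C*-identity makes the norm multiplicative on the powers with exponent
    [2 ^ n] of a self-adjoint element; this replaces the spectral radius. *)
Lemma rnorm_pow2 a n : selfadj a -> rnorm (a ^+ (2 ^ n)) = rnorm a ^+ (2 ^ n).
Proof.
move=> sa; elim: n => [|n IH]; first by rewrite expn0 !expr1.
rewrite expnS mul2n -addnn !exprD rnorm_sq ?IH -?expr2 //.
exact: selfadjX.
Qed.

Lemma sqrB_comm a b : GRing.comm a b -> (a + b) * (a - b) = a * a - b * b.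
Proof. by move=> c; rewrite mulrBr !mulrDl c opprD addrA addrK. Qed.

Let half : R := 2^-1.

(** If [k * k = 1 - y] then [z = 1 - k] is a fixed point of
    [z |-> (y + z * z) / 2], and this is the iteration for [z] from 0.  The same
    iteration with [y = 1] in the real numbers dominates it term by term, and a
    bounded monotone real sequence converges. *)
Fixpoint sqrt_iter y n : A :=
  if n is m.+1 then half%:C *: (y + sqrt_iter y m * sqrt_iter y m) else 0.

Fixpoint sqrt_bound n : R :=
  if n is m.+1 then half * (1 + sqrt_bound m * sqrt_bound m) else 0.

Lemma half_ge0 : 0 <= half. Proof. by rewrite /half invr_ge0. Qed.

Lemma sqrt_bound01 n : 0 <= sqrt_bound n <= 1.
Proof. by elim: n => [|n IH] /=; rewrite /half; nra. Qed.

Lemma sqrt_bound_nd n : sqrt_bound n <= sqrt_bound n.+1.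
Proof. by have := sqrt_bound01 n; rewrite /= /half; nra. Qed.

Lemma sqrt_iter_comm y b n : GRing.comm b y -> GRing.comm b (sqrt_iter y n).
Proof.
move=> cby; elim: n => [|n IH] /=; first exact: commr0.
rewrite /GRing.comm mulZl mulZr; congr (_ *: _).
by apply: commrD => //; apply: commrM.
Qed.

Lemma sqrt_iter_selfadj y n : selfadj y -> selfadj (sqrt_iter y n).
Proof.
move=> sy; elim: n => [|n IH] /=; first exact: star0.
by apply: selfadjZ; apply: selfadjD => //; apply: selfadj_sq.
Qed.

Lemma sqrt_iter_norm y n : rnorm y <= 1 -> rnorm (sqrt_iter y n) <= sqrt_bound n.
Proof.
move=> y1; elim: n => [|n IH] /=; first by rewrite rnorm0.
rewrite rnormZr ?half_ge0 // ler_wpM2l ?half_ge0 //.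
apply: le_trans (rnormD _ _) _; apply: lerD => //.
by apply: le_trans (rnormM _ _) _; apply: ler_pM; rewrite ?rnorm_ge0.
Qed.

(** The difference of consecutive values of [z * z] factors because all iterates
    commute, so it is dominated by the same factorization for the real
    iteration. *)
Lemma sqrt_iter_step y n : rnorm y <= 1 ->
  rnorm (sqrt_iter y n.+1 - sqrt_iter y n) <= sqrt_bound n.+1 - sqrt_bound n.
Proof.
move=> y1; elim: n => [|n IH].
  by rewrite /= !subr0 !mulr0 !addr0 rnormZr ?half_ge0 // ler_wpM2l // half_ge0.
set z := sqrt_iter y in IH *; set r := sqrt_bound in IH *.
have -> : z n.+2 - z n.+1 = half%:C *: ((z n.+1 + z n) * (z n.+1 - z n)).
  rewrite [z n.+2]/= {2}[z n.+1]/= -scalerBr; congr (_ *: _).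
  have -> : y + z n.+1 * z n.+1 - (y + z n * z n) = z n.+1 * z n.+1 - z n * z n.
    by rewrite opprD addrACA subrr add0r.
  rewrite sqrB_comm //; apply: sqrt_iter_comm; apply: commr_sym.
  exact: sqrt_iter_comm.
have -> : r n.+2 - r n.+1 = half * ((r n.+1 + r n) * (r n.+1 - r n)).
  have E m : r m.+1 = half * (1 + r m * r m) by [].
  by rewrite (E n.+1) {3}(E n); ring.
rewrite rnormZr ?half_ge0 // ler_wpM2l ?half_ge0 //.
apply: le_trans (rnormM _ _) _; apply: ler_pM; rewrite ?rnorm_ge0 //.
apply: le_trans (rnormD _ _) _; apply: lerD; exact: sqrt_iter_norm.
Qed.

Lemma sqrt_iter_cvg y : rnorm y <= 1 -> cvgn (sqrt_iter y).
Proof.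
move=> y1.
have nd : nondecreasing_seq sqrt_bound by apply/nondecreasing_seqP/sqrt_bound_nd.
have cr : cvgn sqrt_bound.
  apply: nondecreasing_is_cvgn => //; exists 1 => _ [n _ <-].
  by case/andP: (sqrt_bound01 n).
have st n m : (n <= m)%N ->
    rnorm (sqrt_iter y m - sqrt_iter y n) <= sqrt_bound m - sqrt_bound n.
  move=> /subnKC <-; elim: (m - n)%N => [|d IH]; first by rewrite addn0 !subrr rnorm0.
  rewrite addnS; have := sqrt_iter_step (n + d) y1.
  have := rnormD (sqrt_iter y (n + d).+1 - sqrt_iter y (n + d))
                 (sqrt_iter y (n + d) - sqrt_iter y n).
  rewrite addrA subrK => *; lra.
apply: rnorm_cauchy => e e0.
have /cvgrPdist_lt/(_ _ e0)[N _ hN] := cr.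
exists N => n m Nn nm; apply: le_lt_trans (st _ _ nm) _.
have := hN n Nn; rewrite /= ltr_norml => /andP[_ h].
apply: le_lt_trans h; rewrite lerD2r.
exact: nondecreasing_cvgn_le.
Qed.

(** The bound on [1 - k] says that [k] is again positive in the sense used below,
    and the commutation clause stands for [k] being a limit of polynomials
    in [y]. *)
Lemma sqrt1B y : selfadj y -> rnorm y <= 1 -> exists k,
  [/\ selfadj k, k * k = 1 - y, rnorm (1 - k) <= 1 &
      forall b, GRing.comm b y -> GRing.comm b k].
Proof.
move=> sy y1; pose u := sqrt_iter y; pose z := limn u.
have uz e : 0 < e -> exists n, rnorm (z - u n) < e /\ rnorm (z - u n.+1) < e.
  move=> e0; have /rnorm_cvgP/(_ _ e0)[N hN] := sqrt_iter_cvg y1.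
  by exists N; split; apply: hN.
have un1 n : rnorm (u n) <= 1.
  by apply: le_trans (sqrt_iter_norm n y1) _; case/andP: (sqrt_bound01 n).
have z1 : rnorm z <= 1.
  apply/ler_addgt0Pr => e /uz[n [h _]].
  have := rnormD (z - u n) (u n); rewrite subrK; have := un1 n; lra.
have sz : selfadj z.
  apply/eqP; rewrite -subr_eq0; apply/eqP; apply: (@rnorm_small_eq0 _ _ 2) => e /uz[n [h _]].
  have -> : star z - z = star (z - u n) - (z - u n).
    by rewrite starB (sqrt_iter_selfadj n sy) opprB addrA subrK.
  by have := rnormD (star (z - u n)) (- (z - u n)); rewrite rnormN rnorm_star; lra.
have cz b : GRing.comm b y -> GRing.comm b z.
  move=> cb; apply/eqP; rewrite -subr_eq0; apply/eqP.
  apply: (@rnorm_small_eq0 _ _ (2 * rnorm b)) => e /uz[n [h _]].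
  have -> : b * z - z * b = b * (z - u n) - (z - u n) * b.
    by rewrite mulrBr mulrBl (sqrt_iter_comm n cb) opprB addrA subrK.
  have := rnormD (b * (z - u n)) (- ((z - u n) * b)); rewrite rnormN.
  have := rnormM b (z - u n); have := rnormM (z - u n) b.
  have := rnorm_ge0 b; nra.
have ez : z = half%:C *: (y + z * z).
  apply/eqP; rewrite -subr_eq0; apply/eqP.
  apply: (@rnorm_small_eq0 _ _ 2) => e /uz[n [h h']].
  have -> : z - half%:C *: (y + z * z) =
      (z - u n.+1) - half%:C *: (z * (z - u n) + (z - u n) * u n).
    rewrite [u n.+1]/= -/(u n) -addrA -opprD -scalerDr; congr (_ - _ *: _).
    have -> : z * (z - u n) + (z - u n) * u n = z * z - u n * u n.
      by rewrite mulrBr mulrBl addrA subrK.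
    by rewrite -addrA [u n * u n + _]addrC subrK.
  have := rnormD (z - u n.+1) (- (half%:C *: (z * (z - u n) + (z - u n) * u n))).
  rewrite rnormN rnormZr ?half_ge0 //.
  have := rnormD (z * (z - u n)) ((z - u n) * u n).
  have := rnormM z (z - u n); have := rnormM (z - u n) (u n).
  have := un1 n; have := rnorm_ge0 (u n); have := rnorm_ge0 z.
  have := rnorm_ge0 (z - u n).
  have -> : half = 1/2 by rewrite /half mul1r.
  move=> h1 h2 h3 h4 h5 h6 h7 h8.
  have : rnorm z * rnorm (z - u n) <= e by nra.
  have : rnorm (z - u n) * rnorm (u n) <= e by nra.
  lra.
exists (1 - z); split.
- exact: selfadjB selfadj1 sz.
- have e2 : z + z = y + z * z.
    rewrite {1 2}ez -scalerDl -rmorphD /=.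
    have -> : half + half = 1 by rewrite /half; lra.
    by rewrite scale1r.
  rewrite mulrBr mulr1 mulrBl mul1r opprB -addrA; congr (_ + _).
  have -> : z * z = z + z - y by rewrite e2 addrAC subrr add0r.
  by rewrite addrAC addrK addKr.
- by rewrite opprB addrC subrK.
- by move=> b /cz cb; apply: commrB => //; apply: commr1.
Qed.
End CStar.

(** * Positive elements *)

Section Positive.
Variables (R : realType) (A : cstarAlgType R).
Implicit Types a b c h k l x y z : A.

Definition scal (t : R) : A := t%:C *: (1 : A).

Lemma scalD s t : scal (s + t) = scal s + scal t.
Proof. by rewrite /scal rmorphD scalerDl. Qed.

Lemma scal0 : scal 0 = 0.
Proof. by rewrite /scal scale0r. Qed.

Lemma scalM (t : R) a : scal t * a = t%:C *: a.
Proof. by rewrite /scal mulZl mul1r. Qed.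

Lemma scal_comm t a : GRing.comm a (scal t).
Proof. by rewrite /GRing.comm scalM /scal mulZr mulr1. Qed.

Lemma selfadj_scal t : selfadj (scal t).
Proof. by apply: selfadjZ; apply: selfadj1. Qed.

(** For self-adjoint [h] this condition is equivalent to the spectrum of [h]
    lying in the half-line of nonnegative reals.  In this form positive elements
    visibly make a convex cone. *)
Definition positive h := selfadj h /\ exists t : R, rnorm (scal t - h) <= t.

Lemma pos_bound h : positive h -> exists2 t : R, 0 < t & rnorm (scal t - h) <= t.
Proof.
move=> [_ [t ht]]; have t0 : 0 <= t := le_trans (rnorm_ge0 _) ht.
(* The radius [t] may be 0; the centre is moved to make it positive. *)
exists (t + 1); first by lra.
rewrite scalD addrAC; apply: le_trans (rnormD _ _) _.
by apply: lerD => //; apply: rnorm_scalar.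
Qed.

Lemma posD x y : positive x -> positive y -> positive (x + y).
Proof.
move=> [sx [s hs]] [sy [t ht]]; split; first exact: selfadjD.
exists (s + t); rewrite scalD opprD addrACA.
by apply: le_trans (rnormD _ _) _; apply: lerD.
Qed.

Lemma pos0 : positive 0.
Proof.
by split; [exact: star0 | exists 0; rewrite scal0 subr0 rnorm0].
Qed.

Lemma posZ (s : R) x : 0 <= s -> positive x -> positive (s%:C *: x).
Proof.
move=> s0 [sx [t ht]]; split; first exact: selfadjZ.
exists (s * t); rewrite /scal rmorphM /= -scalerA -scalerBr rnormZr //.
by rewrite ler_wpM2l.
Qed.

Lemma pos_sum (I : Type) (r : seq I) (P : pred I) (F : I -> A) :
  (forall i, P i -> positive (F i)) -> positive (\sum_(i <- r | P i) F i).
Proof. by move=> h; apply: big_rec => [|i x /h pi px]; [exact: pos0|exact: posD]. Qed.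

Lemma pos_scal_sub (t : R) h : selfadj h -> rnorm h <= t -> positive (scal t - h).
Proof.
move=> sh ht; split; first exact: selfadjB (selfadj_scal t) sh.
by exists t; rewrite opprB addrCA subrr addr0.
Qed.

Lemma pos_sqrt h : positive h -> exists k,
  [/\ positive k, k * k = h & forall b, GRing.comm b h -> GRing.comm b k].
Proof.
move=> ph; have sh := ph.1; have [t t0 ht] := pos_bound ph.
pose y := 1 - (t^-1)%:C *: h.
have ti0 : 0 <= t^-1 by rewrite invr_ge0 ltW.
have ey : y = (t^-1)%:C *: (scal t - h).
  by rewrite scalerBr /scal scalerA -rmorphM /= mulVf ?gt_eqF // scale1r.
have y1 : rnorm y <= 1.
  by rewrite ey rnormZr // ler_pdivrMl // mulr1.
have sy : selfadj y by apply: selfadjB; [exact: selfadj1|exact: selfadjZ].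
have [k [sk kk k1 ck]] := sqrt1B sy y1.
have st := sqrtr_ge0 t.
exists ((Num.sqrt t)%:C *: k); split.
- apply: posZ => //; split=> //; exists 1.
  by rewrite /scal scale1r.
- rewrite mulZl mulZr scalerA -rmorphM /= -expr2 sqr_sqrtr ?ltW // kk.
  by rewrite /y opprB addrC subrK scalerA -rmorphM /= mulfV ?gt_eqF // scale1r.
- move=> b cb; rewrite /GRing.comm mulZr mulZl; congr (_ *: _).
  apply: ck; apply: commrB; first exact: commr1.
  by rewrite /GRing.comm mulZr mulZl cb.
Qed.

(** The element [k + i l] is the square root of [t] times a unitary, and [k] is
    its real part. *)
Lemma rnorm_unitary_trick k l (t : R) : selfadj k -> selfadj l ->
  GRing.comm k l -> 0 <= t -> k * k + l * l = scal t -> rnorm (k * k) <= t.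
Proof.
move=> sk sl ckl t0 e; pose w := k + 'i%C *: l.
have sw : star w = k - 'i%C *: l.
  rewrite /w starD starZ sk sl; congr (_ + _).
  by rewrite -scaleNr; congr (_ *: _); apply/eqP; rewrite eq_complex /= oppr0 !eqxx.
have ww : star w * w = scal t.
  rewrite sw -e /w mulrDr !mulrBl !mulZl !mulZr ckl scalerA.
  have -> : 'i%C * 'i%C = -1 :> R[i] by rewrite -expr2 sqr_i.
  by rewrite scaleN1r opprK addrA subrK.
have w2 : rnorm w ^+ 2 <= t by rewrite -rnorm_star_mul ww rnorm_scalar.
rewrite rnorm_sq //; apply: le_trans w2.
rewrite ler_pXn2r ?nnegrE ?rnorm_ge0 //.
have e2 : k + k = star w + w by rewrite sw /w addrCA addrA -addrA subrK.
have : rnorm (k + k) <= rnorm w + rnorm w.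
  by rewrite e2 -{1}(rnorm_star w); exact: rnormD.
have -> : k + k = (2:R)%:C *: k by rewrite [(2 : R)%:C]rmorphD scalerDl !scale1r.
by rewrite rnormZr //; lra.
Qed.

(** With [t] the norm of [x + y], both [x] and [t - x] are positive; their square
    roots commute, and the squares of these add up to [t]. *)
Lemma rnorm_pos_le x y : positive x -> positive y -> rnorm x <= rnorm (x + y).
Proof.
move=> px py; set t := rnorm (x + y).
have [k [[sk _] kk ck]] := pos_sqrt px.
have ptx : positive (scal t - x).
  have -> : scal t - x = (scal t - (x + y)) + y by rewrite opprD addrA subrK.
  apply: posD => //; apply: pos_scal_sub => //.
  by apply: selfadjD; [case: px|case: py].
have [l [[sl _] ll cl]] := pos_sqrt ptx.
rewrite -kk; apply: (@rnorm_unitary_trick _ l) => //.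
- apply: cl; apply: commrB; first exact: scal_comm.
  by apply/commr_sym/ck.
- exact: rnorm_ge0.
- by rewrite kk ll addrC subrK.
Qed.

Lemma pos_eq0 x : positive x -> positive (- x) -> x = 0.
Proof.
move=> px pNx; apply: rnorm_eq0; apply/eqP; rewrite eq_le rnorm_ge0 andbT.
by have := rnorm_pos_le px pNx; rewrite subrr rnorm0.
Qed.

(** With [t] the norm of [h * h], the element [t - h * h] is positive and has a
    square root [l] that commutes with [h]; hence the norm of [l * l] is at
    most [t]. *)
Lemma pos_sq h : selfadj h -> positive (h * h).
Proof.
move=> sh; have s2 := selfadj_sq sh; split=> //; exists (rnorm (h * h)).
set t := rnorm (h * h).
have [l [[sl _] ll cl]] := pos_sqrt (pos_scal_sub s2 (lexx t)).
rewrite -ll; apply: (@rnorm_unitary_trick _ h) => //.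
- apply/commr_sym/cl/commrB; first exact: scal_comm.
  exact: commrM.
- exact: rnorm_ge0.
- by rewrite ll subrK.
Qed.

(** An exponential with base above 1 would outgrow a linear function; the square
    of Bernoulli's inequality already does. *)
Lemma pow2_growth (r K : R) : 0 <= r -> 0 <= K ->
  (forall n, r ^+ (2 ^ n) <= 1 + (2 ^ n)%:R * K) -> r <= 1.
Proof.
move=> r0 K0 h; rewrite leNgt; apply/negP => r1.
pose e := r - 1; have e0 : 0 < e by rewrite /e; lra.
have bern m : 1 + m%:R * e <= r ^+ m.
  elim: m => [|m IH]; first by rewrite mul0r addr0 expr0.
  have er : r = 1 + e by rewrite /e; lra.
  rewrite exprS -natr1; move: (r ^+ m) IH (ler0n R m) => s IH m0.
  rewrite er; nra.
have hm n : (2 ^ n)%:R * e ^+ 2 <= 2 * K.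
  have := h n.+1; rewrite expnS mulnC exprM => hn.
  have m0 : (0 : R) < (2 ^ n)%:R by rewrite ltr0n expn_gt0.
  have := bern (2 ^ n)%N; move: hn; rewrite natrM; set m := (2 ^ n)%:R in m0 *.
  set s := r ^+ _ => hn hb.
  have me0 : 0 < m * e by rewrite mulr_gt0.
  have : (1 + m * e) ^+ 2 <= 1 + m * 2 * K.
    by apply: le_trans hn; rewrite ler_pXn2r // nnegrE; lra.
  have -> : (1 + m * e) ^+ 2 = 1 + 2 * (m * e) + m * (m * e ^+ 2) by ring.
  by move=> hh; rewrite -(ler_pM2l m0); lra.
pose n := Num.trunc (2 * K / e ^+ 2).
have hn : 2 * K / e ^+ 2 < (2 ^ n)%:R.
  apply: lt_le_trans (_ : n.+1%:R <= _); last by rewrite ler_nat ltn_expl.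
  by rewrite truncnS_gt.
move: hn; rewrite ltr_pdivrMr ?exprn_gt0 //; have := hm n; lra.
Qed.

(** A substitute for spectral arguments.  Put [d = t - b].  Since
    [d ^+ n.+1 = t d ^+ n - b d ^+ n], the hypothesis lets the norm of [d ^+ n]
    exceed [t ^+ n] by no more than a factor linear in [n].  Along powers of two
    that norm is the power of the norm of [d], which excludes a norm
    above [t]. *)
Lemma rnorm_scal_sub_le b (t K : R) : selfadj b -> 0 < t ->
  (forall n, rnorm (b * (scal t - b) ^+ n) <= K * t ^+ n) ->
  rnorm (scal t - b) <= t.
Proof.
move=> sb t0 h; set d := scal t - b in h *.
have sd : selfadj d by apply: selfadjB => //; apply: selfadj_scal.
have K0 : 0 <= K.
  by have := h 0; rewrite !expr0 !mulr1; apply: le_trans; apply: rnorm_ge0.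
have dn n : rnorm (d ^+ n) <= t ^+ n * (1 + n%:R * (K / t)).
  elim: n => [|n IH]; first by rewrite !expr0 mul0r addr0 mulr1 rnorm1_le1.
  have -> : d ^+ n.+1 = t%:C *: d ^+ n - b * d ^+ n.
    by rewrite exprS {1}/d mulrBl scalM.
  apply: le_trans (rnormD _ _) _; rewrite rnormN (rnormZr _ (ltW t0)).
  have -> : t ^+ n.+1 * (1 + n.+1%:R * (K / t)) =
            t * (t ^+ n * (1 + n%:R * (K / t))) + K * t ^+ n.
    by rewrite exprS -natr1; field; rewrite gt_eqF.
  by apply: lerD; [rewrite ler_pM2l | exact: h].
rewrite -(ler_pM2r (_ : 0 < t^-1)) ?invr_gt0 // mulfV ?gt_eqF //.
apply: (@pow2_growth _ (K / t)).
- by apply: divr_ge0; [exact: rnorm_ge0 | exact: ltW].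
- by apply: divr_ge0 => //; exact: ltW.
move=> n; rewrite exprMn -rnorm_pow2 // exprVn ler_pdivrMr ?exprn_gt0 //.
by rewrite mulrC.
Qed.

(** Here [k] is the absolute value of [h], and [k - h] is twice its negative
    part.  The product of [b = k - h] with [k + h] vanishes, so in [b (t - b) ^+ n]
    the factors [t - b] may be replaced by [t - 2 k], whose norm is at
    most [t] for large [t]. *)
Lemma pos_abs_sub h k : selfadj h -> positive k -> k * k = h * h -> GRing.comm h k ->
  positive (k - h).
Proof.
move=> sh pk kk chk; have sk := pk.1; set b := k - h.
have sb : selfadj b by apply: selfadjB.
have [t t0 ht] := pos_bound (posD pk pk); split=> //; exists t.
have br : b * (k + h) = 0.
  by rewrite /b mulrBl !mulrDr kk chk [k * h + _]addrC subrr.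
apply: (@rnorm_scal_sub_le _ _ (rnorm b)) => //.
have cbt : GRing.comm b (scal t - b) by apply: commrB => //; apply: scal_comm.
have bt : b * (scal t - b) = b * (scal t - (k + k)).
  have -> : scal t - (k + k) = scal t - b - (k + h).
    by rewrite -[in RHS]addrA -opprD /b addrACA [- h + h]addrC subrr addr0.
  by rewrite [RHS]mulrBr br subr0.
have cbk : GRing.comm b (k + k).
  have : GRing.comm b k by apply/commr_sym/commrB => //; apply/commr_sym.
  by move=> c; apply: commrD.
have bn n : b * (scal t - b) ^+ n = (scal t - (k + k)) ^+ n * b.
  have ct : GRing.comm b (scal t - (k + k)).
    by apply: commrB => //; apply: scal_comm.
  elim: n => [|n IH]; first by rewrite !expr0 mulr1 mul1r.
  by rewrite exprS mulrA bt ct -mulrA IH mulrA -exprS.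
move=> n; rewrite bn [leRHS]mulrC.
apply: le_trans (rnormM _ _) _; rewrite ler_wpM2r ?rnorm_ge0 //.
apply: le_trans (rnormX_le _ _) _.
by apply: lerXn2r => //; rewrite nnegrE ?rnorm_ge0 // ltW.
Qed.
End Positive.

(** * Positivity of star a * a *)

Section Kaplansky.
Variables (R : realType) (A : cstarAlgType R).
Implicit Types a b c h k l x y z : A.

Lemma scale2r (a : A) : (2 : R)%:C *: a = a + a.
Proof. by rewrite [(2 : R)%:C]rmorphD scalerDl !scale1r. Qed.

Lemma pos_half a : positive (a + a) -> positive a.
Proof.
rewrite -scale2r => /(@posZ _ _ 2^-1 _) p.
have -> : a = (2^-1 : R)%:C *: ((2 : R)%:C *: a).
  by rewrite scalerA -rmorphM /= mulVf ?scale1r // pnatr_eq0.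
by apply: p; rewrite invr_ge0.
Qed.

(** Up to a positive factor this is the sum of the squares of the real and imaginary
    parts of [c]. *)
Lemma star_mul_add_pos c : positive ((star c * c + c * star c) + (star c * c + c * star c)).
Proof.
(* Twice the real part and, up to sign, twice the imaginary part of [c]. *)
pose x := c + star c; pose y := 'i%C *: (c - star c).
have sx : selfadj x by rewrite /selfadj /x starD starK addrC.
have sy : selfadj y.
  rewrite /selfadj /y starZ starB starK.
  have -> : 'i%C^* = - 'i%C :> R[i] by apply/eqP; rewrite eq_complex /= oppr0 !eqxx.
  by rewrite scaleNr -scalerN opprB.
have -> : star c * c + c * star c + (star c * c + c * star c) = x * x + y * y.
  rewrite /y mulZl mulZr scalerA.
  have -> : 'i%C * 'i%C = -1 :> R[i] by rewrite -expr2 sqr_i.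
  have ex : x * x = (c * c + star c * star c) + (star c * c + c * star c).
    by rewrite /x mulrDl !mulrDr [star c * c + _ in LHS]addrC addrACA
      [c * star c + _]addrC.
  have ey : (c - star c) * (c - star c) =
      (c * c + star c * star c) - (star c * c + c * star c).
    by rewrite mulrBl !mulrBr opprB addrACA opprD [- (star c * c) - _]addrC.
  by rewrite scaleN1r ex ey opprB [RHS]addrC [RHS]addrA subrK.
by apply: posD; apply: pos_sq.
Qed.

(** The spectra of [star c * c] and [c * star c] agree away from 0.  This weaker
    form follows by moving [c] across the powers of [t - c * star c]. *)
Lemma pos_star_mul_swap c : positive (c * star c) -> positive (star c * c).
Proof.
move=> /pos_bound[t t0 ht]; split; first exact: selfadj_star_mul.
exists t; apply: (@rnorm_scal_sub_le _ _ _ _ (rnorm c ^+ 2)) => //.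
  exact: selfadj_star_mul.
move=> n.
have -> : star c * c * (scal A t - star c * c) ^+ n =
    star c * (scal A t - c * star c) ^+ n * c.
  rewrite -!mulrA; congr (_ * _); elim: n => [|n IH].
    by rewrite !expr0 mulr1 mul1r.
  rewrite exprSr mulrA IH exprSr -!mulrA; congr (_ * _).
  by rewrite mulrBr mulrBl scal_comm mulrA.
apply: le_trans (rnormM _ _) _.
have h1 : rnorm ((scal A t - c * star c) ^+ n) <= t ^+ n.
  apply: le_trans (rnormX_le _ _) _.
  by apply: lerXn2r => //; rewrite nnegrE ?rnorm_ge0 // ltW.
have h2 := rnormM (star c) ((scal A t - c * star c) ^+ n).
rewrite rnorm_star in h2.
have c0 := rnorm_ge0 c.
rewrite (_ : _ ^+ 2 * _ = rnorm c * t ^+ n * rnorm c); last by ring.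
apply: ler_wpM2r => //; apply: le_trans h2 _; exact: ler_wpM2l.
Qed.

(** Let [n] be twice the negative part of [h = star a * a] and [c = a * n].  Then
    [star c * c = n h n] is negative, being minus half of the cube of [n].
    Hence [c * star c], which differs from a sum of squares by the negative
    [star c * c], is positive, and by the previous lemma so
    is [star c * c].  Being positive and negative it vanishes, so [n = 0]. *)
Theorem pos_star_mul a : positive (star a * a).
Proof.
set h := star a * a; have sh : selfadj h := selfadj_star_mul a.
have [k [pk kk ck]] := pos_sqrt (pos_sq sh).
have chk : GRing.comm h k by apply: ck; apply: commrM.
have pn : positive (k - h) by exact: pos_abs_sub.
have pp : positive (k + h).
  rewrite -[h]opprK; apply: pos_abs_sub => //; first exact: selfadjN.
    by rewrite mulrNN.
  by apply/commr_sym/commrN/commr_sym.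
set n := k - h in pn; have sn : selfadj n := pn.1.
have [m [[sm _] mm cm]] := pos_sqrt pn.
pose c := a * n.
have cc : star c * c = n * h * n.
  by rewrite /c star_mul sn /h !mulrA.
have n3 : star c * c + star c * c = - (n * n * n).
  have nk : n * (k + h) = 0.
    by rewrite /n mulrBl !mulrDr kk chk [k * h + _]addrC subrr.
  rewrite cc -mulrDl -mulrDr -mulNr -mulrN; congr (_ * _).
  have -> : h + h = (k + h) - n by rewrite /n opprB [RHS]addrC [RHS]addrA subrK.
  by rewrite mulrBr nk sub0r mulrN.
have pn3 : positive (n * n * n).
  have -> : n * n * n = (m * m * m) * (m * m * m) by rewrite -mm !mulrA.
  apply: pos_sq; apply: selfadjM => //; first exact: selfadj_sq.
  by apply/commr_sym; apply: commrM.
have pNc : positive (- (star c * c + star c * c)) by rewrite n3 opprK.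
have pNc1 : positive (- (star c * c)) by apply: pos_half; rewrite -opprD.
have pc : positive (star c * c).
  apply: pos_star_mul_swap; apply: pos_half.
  have := posD (star_mul_add_pos c) pNc.
  by rewrite addrACA [X in positive X -> _]addrAC subrr add0r.
have c0 : star c * c = 0 by exact: pos_eq0.
have n30 : n * n * n = 0 by rewrite -[LHS]opprK -n3 c0 addr0 oppr0.
have n0 : n = 0.
  have /eqP : rnorm ((n * n) * (n * n)) = 0 by rewrite mulrA n30 mul0r rnorm0.
  rewrite (rnorm_sq (selfadj_sq sn)) (rnorm_sq sn) !expf_eq0 /= => /eqP.
  exact: rnorm_eq0.
have -> : h = k by apply/esym/eqP; rewrite -subr_eq0 -/n n0.
exact: pk.
Qed.
End Kaplansky.

(** * The standard module is closed under subtraction *)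

Section L2.
Variables (R : realType) (A : wstarAlgType R).
Implicit Types x y : nat -> A.

Definition gram x n m : A := \sum_(n <= j < m) star (x j) * x j.

Lemma gram_pos x n m : positive (gram x n m).
Proof. by apply: pos_sum => j _; apply: pos_star_mul. Qed.

(** Blocks of the Gram series, rather than its partial sums, are what the
    monotonicity of the norm applies to. *)
Lemma l2P x : l2 x <-> forall e : R, 0 < e -> exists N, forall n m,
  (N <= n)%N -> (n <= m)%N -> rnorm (gram x n m) < e.
Proof.
split=> [|h].
  move=> /= /cvg_ex[l /rnorm_cvgP hl] e e0.
  have [N hN] := hl (e / 2) (divr_gt0 e0 (ltr0Sn _ _)).
  exists N => n m Nn nm; rewrite /gram -sub_series_geq //.
  set u := series _ in hN *.
  have -> : u m - u n = (l - u n) - (l - u m) by rewrite opprB [RHS]addrC [RHS]addrA subrK.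
  apply: le_lt_trans (rnormD _ _) _; rewrite rnormN.
  have := hN n Nn; have := hN m (leq_trans Nn nm); lra.
apply: rnorm_cauchy => e /h[N hN]; exists N => n m Nn nm.
by rewrite sub_series_geq //; apply: hN.
Qed.

Lemma gram_parallelogram x y n m :
  gram (x - y) n m + gram (x + y) n m =
  (gram x n m + gram x n m) + (gram y n m + gram y n m).
Proof.
rewrite /gram -!big_split /=; apply: eq_bigr => j _.
set a := x j; set b := y j.
have -> : star ((x - y) j) * (x - y) j =
    (star a * a + star b * b) - (star a * b + star b * a).
  by rewrite -[(x - y) j]/(a - b) starB mulrBl !mulrBr opprB addrACA -opprD.
have -> : star ((x + y) j) * (x + y) j =
    (star a * a + star b * b) + (star a * b + star b * a).
  rewrite -[(x + y) j]/(a + b) starD mulrDl !mulrDr.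
  by rewrite [star b * a + _]addrC addrACA.
by rewrite [LHS]addrACA addNr addr0 [LHS]addrACA.
Qed.

(** By the parallelogram law the blocks of [x - y] are dominated by twice those
    of [x] and [y] together; all these blocks are positive, and the norm is
    monotone on positive elements. *)
Lemma l2B x y : l2 x -> l2 y -> l2 (x - y).
Proof.
move=> /l2P hx /l2P hy; apply/l2P => e e0.
have [N hN] := hx (e / 4) (divr_gt0 e0 (ltr0Sn _ _)).
have [M hM] := hy (e / 4) (divr_gt0 e0 (ltr0Sn _ _)).
exists (maxn N M) => n m; rewrite geq_max => /andP[Nn Mn] nm.
have := rnorm_pos_le (gram_pos (x - y) n m) (gram_pos (x + y) n m).
rewrite gram_parallelogram => h; apply: le_lt_trans h _.
have := rnormD (gram x n m + gram x n m) (gram y n m + gram y n m).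
have := rnormD (gram x n m) (gram x n m).
have := rnormD (gram y n m) (gram y n m).
have := hN n m Nn nm; have := hM n m Mn nm; lra.
Qed.
End L2.

(** * States *)

Section State.
Variables (R : realType) (A : wstarAlgType R) (phi : A -> R[i]).
Hypothesis st : state phi.
Implicit Types a b s u : A.

Lemma state_lin (c : R[i]) a b : phi (c *: a + b) = c * phi a + phi b.
Proof. by case: st => lin _ _; exact: lin. Qed.

Lemma stateD a b : phi (a + b) = phi a + phi b.
Proof. by have := state_lin 1 a b; rewrite scale1r mul1r. Qed.

Lemma state0 : phi 0 = 0.
Proof. by apply: (addrI (phi 0)); rewrite -stateD !addr0. Qed.

Lemma stateZ (c : R[i]) a : phi (c *: a) = c * phi a.
Proof. by have := state_lin c a 0; rewrite state0 !addr0. Qed.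

Lemma stateB a b : phi (a - b) = phi a - phi b.
Proof. by rewrite -scaleN1r stateD stateZ mulN1r. Qed.

Lemma state_sum (I : Type) (r : seq I) (P : pred I) (F : I -> A) :
  phi (\sum_(i <- r | P i) F i) = \sum_(i <- r | P i) phi (F i).
Proof. exact: (big_morph phi stateD state0). Qed.

Lemma state_norm a : complex.Re `|phi a| <= rnorm a.
Proof.
case: st => _ _ op.
have b1 v : rnorm v <= 1 -> complex.Re `|phi v| <= 1.
  move=> v1; rewrite -lee_fin -op; apply: ereal_sup_ubound.
  by exists v.
have [a0|a0] := eqVneq (rnorm a) 0.
  by rewrite (rnorm_eq0 a0) state0 normr0 rnorm0.
have pa : 0 < rnorm a by rewrite lt_neqAle eq_sym a0 rnorm_ge0.
have := b1 (((rnorm a)^-1)%:C *: a).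
have ip : 0 <= (rnorm a)^-1 by rewrite invr_ge0 ltW.
rewrite rnormZr // mulVf // => /(_ (lexx _)).
rewrite stateZ normrM ger0_norm ?ler0c //.
have -> : forall z : R[i], complex.Re (((rnorm a)^-1)%:C * z) = (rnorm a)^-1 * complex.Re z.
  by move=> [p q] /=; rewrite mul0r subr0.
by rewrite ler_pdivrMl // mulr1.
Qed.

Definition stateR a : R := complex.Re (phi a).

Lemma stateRD a b : stateR (a + b) = stateR a + stateR b.
Proof. by rewrite /stateR stateD; case: (phi a) (phi b) => ? ? [? ?]. Qed.

Lemma stateR0 : stateR 0 = 0.
Proof. by rewrite /stateR state0. Qed.

Lemma stateRN a : stateR (- a) = - stateR a.
Proof. by apply: (addrI (stateR a)); rewrite -stateRD !subrr stateR0. Qed.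

Lemma stateRZ (t : R) a : stateR (t%:C *: a) = t * stateR a.
Proof. by rewrite /stateR stateZ; case: (phi a) => p q /=; rewrite mul0r subr0. Qed.

Lemma stateR_sum (I : Type) (r : seq I) (P : pred I) (F : I -> A) :
  stateR (\sum_(i <- r | P i) F i) = \sum_(i <- r | P i) stateR (F i).
Proof. exact: (big_morph stateR stateRD stateR0). Qed.

Lemma state_pos a : 0 <= phi (star a * a).
Proof. by case: st. Qed.

Lemma stateR_pos a : 0 <= stateR (star a * a).
Proof. by have := state_pos a; rewrite lecE => /andP[]. Qed.

Lemma stateR_norm a : stateR a <= rnorm a.
Proof.
apply: le_trans (state_norm a); rewrite -lecR.
have -> : (complex.Re `|phi a|)%:C = `|phi a| by rewrite RRe_real.
apply: le_trans (normc_ge_Re _); rewrite lecR; exact: ler_norm.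
Qed.

Definition sqr_abs (z : R[i]) : R := complex.Re `|z| ^+ 2.

Lemma sqr_absE z : sqr_abs z = complex.Re z ^+ 2 + complex.Im z ^+ 2.
Proof.
rewrite /sqr_abs normc_def /= sqr_sqrtr //.
by rewrite addr_ge0 ?sqr_ge0.
Qed.

(** Nonnegativity of the state at [star (c *: a + b) * (c *: a + b)]
    for [c = 1] and [c = i] shows that the values at [star a * b] and
    [star b * a] are conjugate; then [c] is taken to be a real multiple of the
    value at [star a * b]. *)
Lemma state_cauchy_schwarz a b :
  sqr_abs (phi (star a * b)) <= stateR (star a * a) * stateR (star b * b).
Proof.
have key (c : R[i]) : 0 <= c^* * c * phi (star a * a) + c^* * phi (star a * b)
    + c * phi (star b * a) + phi (star b * b).
  have := state_pos (c *: a + b).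
  rewrite starD starZ mulrDl !mulrDr !mulZl !mulZr !stateD !stateZ.
  by rewrite !mulrA -!addrA.
have := state_pos a; have := state_pos b; rewrite sqr_absE /stateR.
case: (phi (star a * a)) (phi (star b * b)) (phi (star a * b))
  (phi (star b * a)) key => [al al'] [be be'] [p q] [p' q'] key.
rewrite !lecE /= => /andP[/eqP be0 be_ge0] /andP[/eqP al0 al_ge0].
subst be' al'.
have := key 1; have := key 'i%C; rewrite !lecE /=.
move=> /andP[/eqP h1 _] /andP[/eqP h2 _].
have ep : p' = p by lra.
have eq' : q' = - q by lra.
subst p' q'.
(* The discriminant of this quadratic in [s] gives the claim. *)
have h (s : R) : 0 <= s ^+ 2 * (p ^+ 2 + q ^+ 2) * al + 2 * s * (p ^+ 2 + q ^+ 2) + be.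
  have := key ((s * p) +i* (s * q)); rewrite lecE /= => /andP[_].
  by congr (_ <= _); ring.
set w := p ^+ 2 + q ^+ 2 in h *.
have w0 : 0 <= w by rewrite addr_ge0 ?sqr_ge0.
have [a0|a0] := eqVneq al 0.
  rewrite a0 mul0r leNgt; apply/negP => w1.
  have := h (- (be + 1) / w); rewrite a0 mulr0 add0r.
  have -> : 2 * (- (be + 1) / w) * w = - 2 * (be + 1) by field; rewrite gt_eqF.
  lra.
have ap : 0 < al by rewrite lt_neqAle eq_sym a0 al_ge0.
have := h (- al^-1).
have -> : (- al^-1) ^+ 2 * w * al + 2 * - al^-1 * w + be = (al * be - w) / al.
  by field.
by rewrite pmulr_lge0 ?invr_gt0 // subr_ge0.
Qed.

(** The element [rnorm s - s] is positive, hence of the form [k * k], and the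
    state is nonnegative at [star (k * u) * (k * u)]. *)
Lemma state_compress s u : selfadj s ->
  stateR (star u * (s * u)) <= rnorm s * stateR (star u * u).
Proof.
move=> ss; have [k [[sk _] kk _]] := pos_sqrt (pos_scal_sub ss (lexx _)).
have := stateR_pos (k * u); rewrite star_mul sk.
have -> : star u * k * (k * u) = (rnorm s)%:C *: (star u * u) - star u * (s * u).
  rewrite -mulrA (mulrA k) kk mulrBl mulrBr; congr (_ - _).
  by rewrite scalM mulZr.
by rewrite stateRD stateRN stateRZ subr_ge0.
Qed.
End State.

(** * Squared moduli and finite nets of complex sequences *)

Section SqrAbs.
Variable R : realType.
Implicit Types z w : R[i].

Lemma sqr_abs_ge0 z : 0 <= sqr_abs z.
Proof. by rewrite sqr_absE addr_ge0 ?sqr_ge0. Qed.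

(** With [s] and [t] the radii of two balls that contain two sequences, summing
    this inequality gives the triangle inequality of the sequence space with its
    sharp constant. *)
Lemma sqr_absD_weighted z w (s t : R) : 0 < s -> 0 < t ->
  sqr_abs (z + w) <= (1 + t / s) * sqr_abs z + (1 + s / t) * sqr_abs w.
Proof.
move=> s0 t0; rewrite !sqr_absE; case: z w => [a b] [c d] /=.
rewrite -subr_ge0.
have -> : (1 + t / s) * (a ^+ 2 + b ^+ 2) + (1 + s / t) * (c ^+ 2 + d ^+ 2) -
   ((a + c) ^+ 2 + (b + d) ^+ 2) =
   ((t * a - s * c) ^+ 2 + (t * b - s * d) ^+ 2) / (s * t).
  by field; rewrite !gt_eqF.
by apply: divr_ge0; [rewrite addr_ge0 ?sqr_ge0 | rewrite mulr_ge0 ?ltW].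
Qed.

Lemma sqr_absD z w : sqr_abs (z + w) <= 2 * sqr_abs z + 2 * sqr_abs w.
Proof.
have := sqr_absD_weighted z w (ltr01 : (0 : R) < 1) ltr01.
by rewrite divr1.
Qed.

Lemma sqr_absN z : sqr_abs (- z) = sqr_abs z.
Proof. by rewrite /sqr_abs normrN. Qed.

Lemma sqr_abs_sum (I : Type) (r : seq I) (F : I -> R[i]) :
  sqr_abs (\sum_(i <- r) F i) <= 2 ^+ size r * \sum_(i <- r) sqr_abs (F i).
Proof.
elim: r => [|i r IH] /=; first by rewrite !big_nil mulr0 sqr_absE /= expr0n addr0.
rewrite !big_cons; apply: le_trans (sqr_absD _ _) _.
rewrite mulrDr exprS; apply: lerD.
  by rewrite ler_wpM2r ?sqr_abs_ge0 // ler_peMr // exprn_ege1 // ler1n.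
by rewrite -mulrA ler_pM2l.
Qed.

(** The first [N] coordinates stay in a bounded part of a finite-dimensional
    space.  Each is rounded to a grid of mesh [e]; one point of [B] is chosen in
    every cell that [B] meets.  Taking the centres in [B] itself matters later:
    they inherit the tail estimate valid on [B]. *)
Lemma finite_net (X : choiceType) (x0 : X) (B : set X) (g : X -> nat -> R[i]) (K e : R) N :
  0 < e -> (forall x j, B x -> sqr_abs (g x j) <= K) ->
  exists (r : nat) (c : 'I_r -> X), (forall i, B (c i)) /\
    forall x, B x -> exists i, forall j, (j < N)%N ->
      sqr_abs (g x j - g (c i) j) <= 2 * e ^+ 2.
Proof.
move=> e0 gK.
have [B0|[b0 Bb0]] : B = set0 \/ B !=set0.
  by have [->|/set0P] := eqVneq B set0; [left|right].
  by exists 0%N, (fun=> x0); split=> [[]//|x]; rewrite B0.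
have K0 : 0 <= K := le_trans (sqr_abs_ge0 _) (gK _ 0%N Bb0).
pose v t := (t + (K + 1)) / e.
(* A real number with square at most [K] lies between [- (K + 1)] and [K + 1]. *)
pose L := Num.trunc (2 * (K + 1) / e).
have vP t : t ^+ 2 <= K -> 0 <= v t /\ (Num.trunc (v t) < L.+1)%N.
  move=> tK; have h1 : 0 <= t + (K + 1) by nra.
  have h2 : t + (K + 1) <= 2 * (K + 1) by nra.
  split; first by rewrite /v divr_ge0 // ltW.
  by rewrite ltnS le_truncn // /v ler_pM2r // invr_gt0.
pose code (t : R) : 'I_L.+1 := inord (Num.trunc (v t)).
have codeP s t : s ^+ 2 <= K -> t ^+ 2 <= K -> code s = code t -> (s - t) ^+ 2 <= e ^+ 2.
  move=> /vP[s0 sL] /vP[t0 tL] /(congr1 val); rewrite /= !inordK // => st.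
  have /andP[a1 a2] := truncn_itv s0; have /andP[b1 b2] := truncn_itv t0.
  rewrite -st -natr1 in b1 b2; rewrite -natr1 in a2.
  have es : s - t = (v s - v t) * e by rewrite /v; field; rewrite gt_eqF.
  have hd : -1 <= v s - v t <= 1 by apply/andP; split; lra.
  rewrite es exprMn ler_piMl ?sqr_ge0 //.
  by move: (v s - v t) hd => w /andP[w1 w2]; nra.
pose G (x : X) : {ffun 'I_N -> 'I_L.+1 * 'I_L.+1} :=
  [ffun j : 'I_N => (code (complex.Re (g x j)), code (complex.Im (g x j)))].
pose rep d := xget b0 [set x | B x /\ G x = d].
exists #|{: {ffun 'I_N -> 'I_L.+1 * 'I_L.+1}}|, (fun i => rep (enum_val i)).
split=> [i|x Bx]; first by rewrite /rep; case: xgetP => // y _ [].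
exists (enum_rank (G x)) => j jN; rewrite enum_rankK.
have [By eG] : B (rep (G x)) /\ G (rep (G x)) = G x.
  by rewrite /rep; case: xgetP => [y _ //|/(_ x)[]].
have := congr1 (fun f : {ffun _} => f (Ordinal jN)) eG; rewrite !ffunE /=.
move=> [er ei]; have := gK _ j Bx; have := gK _ j By; rewrite !sqr_absE.
move: er ei; case: (g x j) (g (rep (G x)) j) => [p q] [p' q'] /= er ei h1 h2.
have := codeP p p' _ _ (esym er); have := codeP q q' _ _ (esym ei).
have := sqr_ge0 p; have := sqr_ge0 q; have := sqr_ge0 p'; have := sqr_ge0 q'.
move=> *; have : (p - p') ^+ 2 <= e ^+ 2 by apply: codeP (esym er); lra.
have : (q - q') ^+ 2 <= e ^+ 2 by apply: codeP (esym ei); lra.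
lra.
Qed.
End SqrAbs.

(** * Seminorms of P and free submodules *)

Section Seminorm.
Variables (R : realType) (A : wstarAlgType R) (phi : A -> R[i]).
Hypothesis st : state phi.
Variable eta : nat -> A.
Hypothesis eta1 : forall j, stateR phi (star (eta j) * eta j) <= 1.
Implicit Types x y : nat -> A.

Let f x j := phi (star (eta j) * x j).

Lemma coefD x y j : f (x + y) j = f x j + f y j.
Proof. by rewrite /f -stateD // -mulrDr. Qed.

Lemma coefB x y j : f (x - y) j = f x j - f y j.
Proof. by rewrite /f -stateB // -mulrBr. Qed.

(** The Cauchy-Schwarz inequality, with the vectors [eta j] of norm at most 1 for
    the state; this bounds the seminorm by the norm of the module. *)
Lemma coef_le x j : sqr_abs (f x j) <= stateR phi (star (x j) * x j).
Proof.
apply: le_trans (state_cauchy_schwarz st _ _) _.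
by rewrite ler_piMl // stateR_pos.
Qed.

Lemma sum_coef_le x n m :
  \sum_(n <= j < m) sqr_abs (f x j) <= stateR phi (gram x n m).
Proof. by rewrite stateR_sum //; apply: ler_sum => j _; apply: coef_le. Qed.

Lemma state_gram_nd x n m : (n <= m)%N ->
  stateR phi (gram x 0 n) <= stateR phi (gram x 0 m).
Proof.
move=> nm; rewrite /gram (@big_cat_nat _ _ _ n 0 m) //= stateRD //.
by rewrite lerDl stateR_sum //; apply: sumr_ge0 => j _; apply: stateR_pos.
Qed.

(** The index is also asked to exceed [m], so that partial sums can be compared
    by monotonicity. *)
Lemma gram_cvg x e : l2 x -> 0 < e -> forall m, exists2 n, (m <= n)%N &
  rnorm (l2_inner x x - gram x 0 n) < e.
Proof.
move=> hx e0 m; have /rnorm_cvgP/(_ _ e0)[N hN] : series (fun j => star (x j) * x j) @ \oo --> l2_inner x x by exact: hx.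
by exists (maxn m N); rewrite ?leq_maxl //; apply: hN; apply: leq_maxr.
Qed.

Lemma state_gram_le x m : l2 x -> stateR phi (gram x 0 m) <= l2_norm x ^+ 2.
Proof.
move=> hx; rewrite sqr_sqrtr ?rnorm_ge0 //; apply/ler_addgt0Pr => e e0.
have [n mn hn] := gram_cvg hx e0 m.
apply: le_trans (state_gram_nd x mn) _; apply: le_trans (stateR_norm st _) _.
have -> : gram x 0 n = l2_inner x x - (l2_inner x x - gram x 0 n).
  by rewrite opprB addrC subrK.
by apply: le_trans (rnormD _ _) _; rewrite rnormN lerD2l ltW.
Qed.

Lemma state_inner_le x K : l2 x -> (forall m, stateR phi (gram x 0 m) <= K) ->
  stateR phi (l2_inner x x) <= K.
Proof.
move=> hx h; apply/ler_addgt0Pr => e e0.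
have [n _ hn] := gram_cvg hx e0 0.
have := stateR_norm st (l2_inner x x - gram x 0 n).
rewrite stateRD // stateRN //; have := h n; lra.
Qed.

Lemma p_seminorm_le x c : 0 <= c ->
  (forall n, \sum_(0 <= j < n) sqr_abs (f x j) <= c ^+ 2) -> p_seminorm phi eta x <= c.
Proof.
move=> c0 h; rewrite /p_seminorm -[leRHS]ger0_norm // -sqrtr_sqr ler_wsqrtr //.
apply: limr_le; last by near=> n; apply: h.
apply: nondecreasing_is_cvgn.
  by apply: nondecreasing_series => n _ _; apply: sqr_abs_ge0.
by exists (c ^+ 2) => _ [n _ <-]; apply: h.
Unshelve. all: by end_near. Qed.

Section Free.
Variables (M : set (nat -> A)) (n : nat) (T : ('I_n -> A) -> (nat -> A)).
Hypothesis Ml2 : M `<=` @l2 R A.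
Hypothesis Tbij : set_bij setT M T.
Hypothesis TD : forall u v, T (u + v) = T u + T v.
Hypothesis Tact : forall u a, T (ract u a) = ract (T u) a.
Hypothesis Tinner : forall u v, l2_inner (T u) (T v) = free_inner u v.

Let e (i : 'I_n) : 'I_n -> A := fun k => if k == i then 1 else 0.

(** The module [M] is generated by the images of the standard basis vectors. *)
Lemma free_expand u j : T u j = \sum_(i < n) T (e i) j * u i.
Proof.
have T0 : T 0 = 0 by apply: (addrI (T 0)); rewrite -TD !addr0.
have -> : u = \sum_(i < n) ract (e i) (u i).
  apply/funext => k; rewrite fct_sumE (bigD1 k) //= /ract /e eqxx mul1r.
  by rewrite big1 ?addr0 // => i /negPf; rewrite eq_sym => ->; rewrite mul0r.
rewrite (big_morph T TD T0) fct_sumE; apply: eq_bigr => i _.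
rewrite Tact /ract; congr (_ * _).
rewrite fct_sumE (bigD1 i) //= /ract /e eqxx mul1r.
by rewrite big1 ?addr0 // => k /negPf; rewrite eq_sym => ->; rewrite mul0r.
Qed.

(** A vector of [M] is a combination of the finitely many generators [T (e i)]
    with coefficients [u i] for which the sum of the state at
    [star (u i) * u i] is at most [K].  The tails of the generators have small
    norm, and [state_compress] carries this over to the combinations with the
    same factor for all of them. *)
Lemma uniform_tail (K d : R) : 0 <= K -> 0 < d -> exists N, forall y, M y ->
  (forall m, stateR phi (gram y 0 m) <= K) ->
  forall m, (N <= m)%N -> \sum_(N <= j < m) sqr_abs (f y j) <= d.
Proof.
move=> K0 d0; pose c : R := 2 ^+ n * (K + 1).
have c0 : 0 < c by rewrite mulr_gt0 ?exprn_gt0 //; lra.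
have MT u : M (T u) by case: Tbij => h _ _; apply: h.
have /choice[Ni hNi] : forall i, exists N, forall k m, (N <= k)%N -> (k <= m)%N ->
    rnorm (gram (T (e i)) k m) < d / c.
  by move=> i; apply: (l2P _).1; [apply: Ml2 | apply: divr_gt0].
exists (\max_i Ni i) => y My yK m Nm; set N := \max_i Ni i in Nm *.
have [u _ eu] : (T @` setT) y by case: Tbij => _ _; apply.
have innK : \sum_(i < n) stateR phi (star (u i) * u i) <= K.
  have := state_inner_le (Ml2 My) yK.
  by rewrite -eu Tinner /free_inner stateR_sum.
have coefT j : sqr_abs (f y j) <=
    2 ^+ n * \sum_(i < n) stateR phi (star (u i) * (star (T (e i) j) * T (e i) j * u i)).
  have -> : f y j = \sum_(i < n) f (ract (T (e i)) (u i)) j.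
    by rewrite /f -eu free_expand mulr_sumr state_sum.
  apply: le_trans (sqr_abs_sum _ _) _.
  rewrite -[index_enum _]enumT size_enum_ord enumT ler_pM2l ?exprn_gt0 //.
  apply: ler_sum => i _; apply: le_trans (coef_le _ _) _.
  by rewrite /ract star_mul !mulrA.
apply: (@le_trans _ _ (\sum_(N <= j < m) (2 ^+ n * \sum_(i < n)
    stateR phi (star (u i) * (star (T (e i) j) * T (e i) j * u i))))).
  by apply: ler_sum => j _.
rewrite -mulr_sumr exchange_big /=.
have tail i : \sum_(N <= j < m) stateR phi (star (u i) * (star (T (e i) j) * T (e i) j * u i))
    <= d / c * stateR phi (star (u i) * u i).
  rewrite -stateR_sum // -mulr_sumr -mulr_suml -/(gram _ _ _).
  apply: le_trans (state_compress st _ (gram_pos _ _ _).1) _.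
  rewrite ler_wpM2r ?stateR_pos // ltW //.
  by apply: hNi => //; apply: leq_bigmax.
apply: (@le_trans _ _ (2 ^+ n * (d / c * K))).
  rewrite ler_pM2l ?exprn_gt0 //; apply: le_trans (ler_sum _ (fun i _ => tail i)) _.
  by rewrite -mulr_sumr ler_pM2l // divr_gt0.
have -> : 2 ^+ n * (d / c * K) = d * (K / (K + 1)).
  rewrite /c; field; rewrite expf_neq0 //= gt_eqF //; lra.
apply: ler_piMr; first exact: ltW.
by rewrite ler_pdivrMr; lra.
Qed.

(** Beyond an index [N] all coordinates contribute little, uniformly on the bounded
    part of [M]; the first [N] coordinates have a finite net. *)
Lemma bounded_net (K d : R) : 0 <= K -> 0 < d ->
  exists (r : nat) (c : 'I_r -> nat -> A), (forall i, M (c i)) /\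
  forall y, M y -> (forall m, stateR phi (gram y 0 m) <= K) ->
  exists i, forall m, \sum_(0 <= j < m) sqr_abs (f (y - c i) j) <= d ^+ 2.
Proof.
move=> K0 d0.
have [N tail] := @uniform_tail K (d ^+ 2 / 8) K0 (divr_gt0 (exprn_gt0 _ d0) (ltr0Sn _ _)).
pose B := [set y | M y /\ forall m, stateR phi (gram y 0 m) <= K].
(* With this mesh the first [N] coordinates contribute at most [d ^+ 2 / 2], and
   the two tails at most [4 * (d ^+ 2 / 8)]. *)
pose e0 := d / (2 * (N%:R + 1)).
have N1 : (0 : R) < N%:R + 1 by rewrite natr1 ltr0Sn.
have e00 : 0 < e0 by rewrite divr_gt0 // mulr_gt0.
have coefK y j : B y -> sqr_abs (f y j) <= K.
  move=> [My yK]; apply: le_trans (yK j.+1); apply: le_trans (coef_le _ _) _.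
  rewrite /gram big_nat_recr //= stateRD // lerDr stateR_sum //.
  by apply: sumr_ge0 => k _; apply: stateR_pos.
have [r [c [cB net]]] := finite_net 0 N e00 coefK.
exists r, c; split=> [i|y My yK]; first by case: (cB i).
have [i hi] := net y (conj My yK); exists i => m.
apply: (@le_trans _ _ (\sum_(0 <= j < N + m) sqr_abs (f (y - c i) j))).
  by apply: nondecreasing_series; [move=> *; apply: sqr_abs_ge0 | rewrite leq_addl].
rewrite (@big_cat_nat _ _ _ N) ?leq_addr //=.
have head : \sum_(0 <= j < N) sqr_abs (f (y - c i) j) <= N%:R * (2 * e0 ^+ 2).
  apply: (@le_trans _ _ (\sum_(0 <= j < N) (2 * e0 ^+ 2))); last first.
    by rewrite sumr_const_nat subn0 -[_ *+ N]mulr_natl.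
  by rewrite big_nat [leRHS]big_nat; apply: ler_sum => j /hi; rewrite coefB.
have headd : N%:R * (2 * e0 ^+ 2) <= d ^+ 2 / 2.
  have -> : N%:R * (2 * e0 ^+ 2) = (d ^+ 2 / 2) * (N%:R / (N%:R + 1) ^+ 2).
    by rewrite /e0; field; rewrite gt_eqF //; lra.
  apply: ler_piMr; first by apply: divr_ge0 => //; apply: sqr_ge0.
  by rewrite ler_pdivrMr ?exprn_gt0 //; have := ler0n R N; nra.
have [Mc cK] := cB i.
have tl := tail _ My yK (N + m)%N (leq_addr _ _).
have tc := tail _ Mc cK (N + m)%N (leq_addr _ _).
have : \sum_(N <= j < N + m) sqr_abs (f (y - c i) j) <=
    \sum_(N <= j < N + m) (2 * sqr_abs (f y j) + 2 * sqr_abs (f (c i) j)).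
  apply: ler_sum => j _; rewrite coefB.
  by apply: le_trans (sqr_absD _ _) _; rewrite sqr_absN.
rewrite big_split /= -!mulr_sumr; lra.
Qed.
End Free.
End Seminorm.

(** * Comparison of the two measures of noncompactness *)

Section Main.
Variables (R : realType) (A : wstarAlgType R).

(** A point [x] of [E] is within [t] of some [v] in [M], and by the parallelogram
    law these [v] stay in a bounded part of [M], where [bounded_net] gives a
    net of mesh [d / 2] for the seminorm. *)
Lemma chi_le (phi : A -> R[i]) (y : nat -> A) (E M : set (nat -> A)) (t d : R) :
  state phi -> (forall j, stateR phi (star (y j) * y j) <= 1) ->
  l2_bounded E -> free_fg_submodule M -> 0 < t -> 0 < d ->
  (l2_excess E M < t%:E)%E -> (chi E (p_seminorm phi y) <= (t + d)%:E)%E.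
Proof.
move=> st y1 [El2 [C EC]] [[Ml2 _ _ _] _ [n [T [Tb TD Ta Ti]]]] t0 d0 ex.
(* [v = x - (x - v)], where [x] has norm at most [C] and [x - v] at most [t]. *)
pose K := 2 * (C ^+ 2 + t ^+ 2).
have K0 : 0 <= K by rewrite mulr_ge0 // addr_ge0 ?sqr_ge0.
have d20 : 0 < d / 2 by rewrite divr_gt0.
have [r [c [Mc net]]] := bounded_net st y1 Ml2 Tb TD Ta Ti K0 d20.
apply: ereal_inf_lbound; exists (t + d) => //; split; first by lra.
exists r, c; split=> [i|x Ex]; first exact: Ml2.
have [v My xy] : exists2 v, M v & l2_norm (x - v) < t.
  have : (ereal_inf [set (l2_norm (x - v))%:E | v in M] < t%:E)%E.
    by apply: le_lt_trans ex; apply: ereal_sup_ubound; exists x.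
  by move=> /ereal_inf_lt[_ [v Mv <-]]; rewrite lte_fin; exists v.
have hx := El2 _ Ex; have hv := Ml2 _ My; have hxv := l2B hx hv.
have n0 (w : nat -> A) : 0 <= l2_norm w by exact: sqrtr_ge0.
have xv2 : l2_norm (x - v) ^+ 2 <= t ^+ 2 by rewrite ler_pXn2r ?nnegrE // ltW.
have vK m : stateR phi (gram v 0 m) <= K.
  have x2 : l2_norm x ^+ 2 <= C ^+ 2.
    have xC := EC _ Ex; have C0 := le_trans (n0 x) xC.
    by rewrite ler_pXn2r ?nnegrE.
  have := gram_parallelogram x (x - v) 0 m.
  have -> : x - (x - v) = v by rewrite opprB addrC subrK.
  move=> /(congr1 (stateR phi)); rewrite !stateRD //.
  have : 0 <= stateR phi (gram (x + (x - v)) 0 m).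
    by rewrite stateR_sum //; apply: sumr_ge0 => j _; apply: stateR_pos.
  have := state_gram_le st m hx; have := state_gram_le st m hxv.
  rewrite /K; lra.
have [i hi] := net v My vK; exists i => //=.
apply: le_lt_trans (_ : t + d / 2 < _); last by lra.
apply: p_seminorm_le => [|m]; first by lra.
have -> : x - c i = (x - v) + (v - c i) by rewrite addrA subrK.
apply: (@le_trans _ _ ((1 + (d / 2) / t) * t ^+ 2 + (1 + t / (d / 2)) * (d / 2) ^+ 2)); last first.
  by rewrite le_eqVlt; apply/orP; left; apply/eqP; field; rewrite !gt_eqF.
have w1 : 0 <= 1 + d / 2 / t by rewrite addr_ge0 // divr_ge0 // ltW.
have w2 : 0 <= 1 + t / (d / 2) by rewrite addr_ge0 // divr_ge0 // ltW.
apply: (@le_trans _ _ ((1 + (d / 2) / t) *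
   (\sum_(0 <= j < m) sqr_abs (phi (star (y j) * (x - v) j))) + (1 + t / (d / 2)) *
   (\sum_(0 <= j < m) sqr_abs (phi (star (y j) * (v - c i) j))))).
  rewrite !mulr_sumr -big_split /=; apply: ler_sum => j _.
  by rewrite (coefD st); apply: sqr_absD_weighted.
apply: lerD; rewrite ler_wpM2l //.
apply: le_trans xv2; apply: le_trans (state_gram_le st m hxv).
exact: sum_coef_le.
Qed.
End Main.

Theorem proposition4p1 (R : realType) (A : wstarAlgType R)
    (E : set (nat -> A)) (hE : l2_bounded E) :
  (chi_star E <= lambda E)%E.
Proof.
apply: ge_ereal_sup => _ [p [phi [y [[_ st] y1 ->]]] <-].
apply: le_ereal_inf_tmp => _ [t [t0 [M fM ex]] <-].
apply/lee_addgt0Pr => d d0; rewrite -EFinD.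
apply: chi_le ex => // j.
by rewrite -lee_fin -y1; apply: ereal_sup_ubound; exists j.
Qed.
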